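(* Let $\mathcal{S}\subset\mathbb{R}^n$ be an open set homeomorphic to $\mathbb{R}^n$, let $f:\mathcal{S}\times\mathbb{R}^m\to\mathcal{S}$ be continuous, and let $\chi^*\in\mathcal{S}$ satisfy $f(\chi^*,0)=\chi^*$. Then the discrete-time system $$\chi(k+1)=f(\chi(k),w(k)),\qquad k\in\mathbb{Z}_+,$$ with state $\chi(k)\in\mathcal{S}$ and disturbance $w\in\ell_\infty^m$, is small-disturbance input-to-state stable if and only if it admits a small-disturbance ISS-Lyapunov function.
   Context: $\mathbb{R}_+=[0,\infty)$; $\mathbb{Z}_+$ is the set of nonnegative integers. $\ell_\infty^m$ is the set of bounded functions $w:\mathbb{Z}_+\to\mathbb{R}^m$, with $\|w\|_\infty=\sup_{k}\|w(k)\|$ (Euclidean norm). Comparison functions. $\alpha:\mathbb{R}_+\to\mathbb{R}_+$ is a $\mathcal{K}$-function if it is continuous, strictly increasing and $\alpha(0)=0$; it is a $\mathcal{K}_\infty$-function if in addition $\alpha(r)\to\infty$ as $r\to\infty$. For $d\in(0,\infty]$, $\alpha:[0,d)\to\mathbb{R}_+$ is a $\mathcal{K}_{[0,d)}$-function if it is continuous, strictly increasing and $\alpha(0)=0$. $\beta:\mathbb{R}_+\times\mathbb{R}_+\to\mathbb{R}_+$ is a $\mathcal{KL}$-function if $\beta(\cdot,t)$ is a $\mathcal{K}$-function for each fixed $t\ge0$ and, for each fixed $r\ge 0$, $\beta(r,\cdot)$ is decreasing (in the non-strict sense) and tends to $0$ as $t\to\infty$. Size function. $\mathcal{V}:\mathcal{S}\to\mathbb{R}_+$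 is a size function for $(\mathcal{S},\chi^* )$ if it is (1) continuous; (2) positive definite with respect to $\chi^*$, i.e. $\mathcal{V}(\chi^* )=0$ and $\mathcal{V}(\chi)>0$ for all $\chi\in\mathcal{S}$, $\chi\ne\chi^*$; (3) coercive, i.e. for any sequence $\{\chi_k\}$ in $\mathcal{S}$ with $\chi_k\to\partial\mathcal{S}$ or $\|\chi_k\|\to\infty$, one has $\mathcal{V}(\chi_k)\to\infty$ as $k\to\infty$. Small-disturbance ISS. The system is small-disturbance input-to-state stable (ISS) if there exist a size function $\mathcal{V}$ for $(\mathcal{S},\chi^* )$, a constant $d>0$ (possibly $\infty$), a $\mathcal{KL}$-function $\beta$ and a $\mathcal{K}_{[0,d)}$-function $\gamma$ such that for all inputs $w$ with $\|w\|_\infty<d$ and all initial states $\chi(0)\in\mathcal{S}$, $\chi(k)$ remains in $\mathcal{S}$ and $\mathcal{V}(\chi(k))\le\beta(\mathcal{V}(\chi(0)),k)+\gamma(\|w\|_\infty)$ for all $k\in\mathbb{Z}_+$. Small-disturbance ISS-Lyapunov function. A function $\mathcal{V}:\mathcal{S}\to\mathbb{R}$ is a small-disturbance ISS-Lyapunov function for the system if (1) $\mathcal{V}$ is a size function for $(\mathcal{S},\chi^* )$; (2) there exist a $\mathcal{K}$-function $\alpha_1$ and a $\mathcal{K}_\infty$-function $\alpha_2$ such that $\mathcal{V}(f(\xi,\mu))-\mathcal{V}(\xi)\le-\alpha_2(\mathcal{V}(\xi))$ for all $\xi\in\mathcal{S}$ and $\mu\in\mathbb{R}^m$ with $\|\mu\|\le\alpha_1(\mathcal{V}(\xi))$.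 *)

(* Defs.v *)
(* R^n is the type of row vectors 'rV[R]_n over an arbitrary R : realType. *)
From HB Require Import structures.
From mathcomp Require Import all_boot all_order all_algebra.
From mathcomp Require Import all_classical all_reals all_analysis.

Set Implicit Arguments.
Unset Strict Implicit.
Unset Printing Implicit Defensive.

Import Order.TTheory GRing.Theory Num.Theory.
Import numFieldNormedType.Exports.

Local Open Scope classical_set_scope.
Local Open Scope ring_scope.

(* The library norm on matrices is the max norm; it induces the same topology. *)
Definition enorm (R : realType) (n : nat) (x : 'rV[R]_n) : R :=
  Num.sqrt (\sum_(i < n) x 0 i ^+ 2).

Definition linf (R : realType) (m : nat) (w : nat -> 'rV[R]_m) : Prop :=
  has_ubound (range (fun k => enorm (w k))).

(* Meaningful only under [linf w]: [sup] of an unbounded set is 0. *)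
Definition linf_norm (R : realType) (m : nat) (w : nat -> 'rV[R]_m) : R :=
  sup (range (fun k => enorm (w k))).

Definition homeomorphic (T U : topologicalType) (A : set T) (B : set U) : Prop :=
  exists (h : T -> U) (g : U -> T),
    [/\ (forall x, A x -> B (h x) /\ g (h x) = x),
        (forall y, B y -> A (g y) /\ h (g y) = y),
        {within A, continuous h} &
        {within B, continuous g}].

Definition boundary (T : topologicalType) (A : set T) : set T :=
  closure A `\` interior A.

(* Comparison functions are total functions R -> R of which only the values on
   the domain D matter. Since the domains used are subsets of [0, +oo[ that
   contain 0, nonnegativity on D follows from the last two clauses. *)
Definition class_K_on (R : realType) (D : set R) (a : R -> R) : Prop :=
  [/\ {within D, continuous a},
      (forall r s, D r -> D s -> r < s -> a r < a s) &
      a 0 = 0].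

Definition class_K (R : realType) (a : R -> R) : Prop :=
  class_K_on [set r | 0 <= r] a.

Definition class_Kinf (R : realType) (a : R -> R) : Prop :=
  class_K a /\ a r @[r --> +oo] --> +oo.

Definition class_K_upto (R : realType) (d : \bar R) (a : R -> R) : Prop :=
  class_K_on [set r | 0 <= r /\ (r%:E < d)%E] a.

Definition class_KL (R : realType) (b : R -> R -> R) : Prop :=
  (forall t, 0 <= t -> class_K (fun r => b r t)) /\
  (forall r, 0 <= r ->
     (forall s t, 0 <= s -> s <= t -> b r t <= b r s) /\
     b r t @[t --> +oo] --> 0).

(* Convergence to the boundary means that the distance to it tends to 0; it
   never holds when the boundary is empty. *)
Definition tends_to_boundary (R : realType) (n : nat) (S : set 'rV[R]_n)
    (u : nat -> 'rV[R]_n) : Prop :=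
  forall e : R, 0 < e ->
    \forall k \near \oo, exists2 y, boundary S y & enorm (u k - y) < e.

Definition coercive (R : realType) (n : nat) (S : set 'rV[R]_n)
    (V : 'rV[R]_n -> R) : Prop :=
  forall u : nat -> 'rV[R]_n, (forall k, S (u k)) ->
    tends_to_boundary S u \/ enorm (u k) @[k --> \oo] --> +oo ->
    V (u k) @[k --> \oo] --> +oo.

(* V stands for a function on S: its values outside S are irrelevant. *)
Definition size_function (R : realType) (n : nat) (S : set 'rV[R]_n)
    (xstar : 'rV[R]_n) (V : 'rV[R]_n -> R) : Prop :=
  [/\ {within S, continuous V},
      V xstar = 0,
      (forall x, S x -> x <> xstar -> 0 < V x) &
      coercive S V].

Definition trajectory (R : realType) (n m : nat)
    (f : 'rV[R]_n * 'rV[R]_m -> 'rV[R]_n)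
    (w : nat -> 'rV[R]_m) (x : nat -> 'rV[R]_n) : Prop :=
  forall k, x k.+1 = f (x k, w k).

Definition small_disturbance_ISS (R : realType) (n m : nat)
    (S : set 'rV[R]_n) (f : 'rV[R]_n * 'rV[R]_m -> 'rV[R]_n)
    (xstar : 'rV[R]_n) : Prop :=
  exists (V : 'rV[R]_n -> R) (d : \bar R) (b : R -> R -> R) (g : R -> R),
    [/\ size_function S xstar V, (0 < d)%E, class_KL b, class_K_upto d g &
        forall (w : nat -> 'rV[R]_m) (x : nat -> 'rV[R]_n),
          linf w -> ((linf_norm w)%:E < d)%E ->
          S (x 0%N) -> trajectory f w x ->
          forall k : nat,
            S (x k) /\ V (x k) <= b (V (x 0%N)) k%:R + g (linf_norm w)].

Definition small_disturbance_ISS_Lyapunov (R : realType) (n m : nat)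
    (S : set 'rV[R]_n) (f : 'rV[R]_n * 'rV[R]_m -> 'rV[R]_n)
    (xstar : 'rV[R]_n) (V : 'rV[R]_n -> R) : Prop :=
  size_function S xstar V /\
  exists a1 a2 : R -> R,
    [/\ class_K a1, class_Kinf a2 &
        forall (x : 'rV[R]_n) (mu : 'rV[R]_m),
          S x -> enorm mu <= a1 (V x) ->
          V (f (x, mu)) - V x <= - a2 (V x)].

(* Main.v *)
Require Import Defs.
From mathcomp Require Import all_boot all_order all_algebra.
From mathcomp Require Import all_classical all_reals all_analysis.
From mathcomp Require Import ring lra.

(** Both implications compare the current disturbance with the current state,
    measured by a size function.

    A Lyapunov function [V] yields input-to-state stability. At a state [x], a
    disturbance [mu] either satisfies [enorm mu <= a1 (V x)], and then [V]
    decreases by at least [a2 (V x)], or it is large compared with [V x]. In the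
    second case [x] is near the equilibrium [xs] whenever [mu] is small, so
    continuity of [f] at [(xs, 0)] makes [V (f (x, mu))] small as well. There is
    thus a gain [g], vanishing at [0], such that each step either applies the
    scalar map [v |-> v - a v], with [a] of class K below [a2], or lands below
    [g] of the sup norm of the disturbance. By induction, [V (x k)] is at most
    the maximum of the [k]-th iterate of that map at [V (x 0)] and the gain;
    the iterates form the KL function ([ISS_of_Lyapunov]).

    Conversely, let [om], [b] and [g] come from the definition of
    input-to-state stability. One chooses a margin [rho] of class K so small
    that, along any trajectory with [enorm (w k) <= rho (om (x k))] and
    [om (x 0) <= r], the gain term never exceeds [r / 2]. Then
    [om (x k) <= b r k + r / 2], which is at most [3 r / 4] after a time
    depending on [r] only; restarting from there shows that all these
    trajectories converge uniformly ([ISS_robustly_stable]). The Lyapunov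
    function is the value function
      [V x = sup_k sup { 2^k F (om (x k)) : x 0 = x }]
    over all trajectories within the margin. Following Sontag, [F] is
    flattened near [0] until [4^k F (om (x k))] is bounded uniformly over
    [om (x 0) <= r] ([fast_decay_gain]). Half of this decay pays for the weight
    [2^k], which gives [V (f (x, mu)) <= V x / 2] within the margin. The other
    half makes the terms of [V] vanish locally uniformly as [k] grows; each
    term is obtained from [F \o om] by iterated suprema over a compact ball,
    hence continuous, and so [V] is continuous ([continuous_sup_vanishing]).

    All comparison functions are produced by a single envelope construction
    ([slow_K_below]). Coercivity of size functions enters through
    [size_function_small]: a small value forces the state to be near [xs]. *)

Set Implicit Arguments.
Unset Strict Implicit.
Unset Printing Implicit Defensive.

Import Order.TTheory GRing.Theory Num.Theory.
Import numFieldNormedType.Exports.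

Local Open Scope classical_set_scope.
Local Open Scope ring_scope.

(** * Comparison functions *)

Lemma class_K_gt0 (R : realType) (a : R -> R) s :
  class_K a -> 0 < s -> 0 < a s.
Proof.
by move=> [_ aS a0] s0; rewrite -a0; apply: aS => //=; exact: ltW.
Qed.

Lemma class_K_le (R : realType) (a : R -> R) s t :
  class_K a -> 0 <= s -> s <= t -> a s <= a t.
Proof.
move=> [_ aS a0] s0; rewrite le_eqVlt => /orP[/eqP->//|st].
by apply/ltW/aS => //=; exact: le_trans (ltW st).
Qed.

Lemma class_K_ge0 (R : realType) (a : R -> R) s :
  class_K a -> 0 <= s -> 0 <= a s.
Proof. by move=> aK s0; have [_ _ <-] := aK; exact: class_K_le. Qed.

Lemma class_K_on_small (R : realType) (D : set R) (a : R -> R) c :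
  class_K_on D a -> D 0 -> 0 < c ->
  exists2 d, 0 < d & forall u, D u -> `|u| < d -> a u < c.
Proof.
move=> [ca _ a0] D0 c0.
have : \forall u \near within D (nbhs 0), a u < c.
  have ca0 : a x @[x --> within D (nbhs 0)] --> a 0.
    by rewrite (nbhs_subspace_in D0); exact: ca.
  by apply: cvgr_lt ca0 _ _; rewrite a0.
rewrite near_withinE -nbhs_ballE => -[d /= d0 dP]; exists d => // u Du ud.
by apply: dP => //; rewrite /ball/= sub0r normrN.
Qed.

Section SlowK.
Variable R : realType.
Implicit Types (a : R -> R) (P : R -> R -> Prop).

(** Bounding increments by those of the identity gives continuity on the whole
    line for free and makes [s - a s] strictly increasing, so that this
    difference can be iterated. The extension by [0] to the left avoids
    subspace topologies. *)
Definition slow_K a :=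
  (forall s, s <= 0 -> a s = 0) /\
  (forall s t, 0 <= s -> s < t -> 0 < a t - a s < t - s).

Lemma slow_K_le a s t : slow_K a -> s <= t -> a s <= a t <= a s + (t - s).
Proof.
move=> [a0 aS] st.
have [t0|t0] := leP t 0; first by rewrite !a0 ?(le_trans st)//; lra.
have [s0|s0] := leP 0 s.
  move: st; rewrite le_eqVlt => /orP[/eqP ->|st]; first by lra.
  by have /andP[h1 h2] := aS _ _ s0 st; apply/andP; split; lra.
have := aS 0 t (lexx _) t0; rewrite (a0 0)// (a0 s (ltW s0)) => /andP[h1 h2].
by apply/andP; split; lra.
Qed.

Lemma slow_K_lt a s t : slow_K a -> 0 <= s -> s < t -> a s < a t.
Proof. by move=> [_ aS] s0 st; have /andP[h1 h2] := aS _ _ s0 st; lra. Qed.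

Lemma slow_K_id a s : slow_K a -> 0 < s -> 0 < a s < s.
Proof.
by move=> [a0 aS] s0; have := aS _ _ (lexx 0) s0; rewrite (a0 0 (lexx _)) !subr0.
Qed.

Lemma slow_K_ge0 a s : slow_K a -> 0 <= a s.
Proof.
move=> aK; have [s0|s0] := leP s 0; first by rewrite aK.1.
by have /andP[/ltW] := slow_K_id aK s0.
Qed.

Lemma slow_K_continuous a : slow_K a -> continuous a.
Proof.
move=> aK x; apply/cvgrPdist_le => /= e e0.
near=> y.
have xye : `|x - y| <= e by near: y; exact: cvgr_dist_le.
apply: le_trans xye.
have [xy|/ltW yx] := leP x y.
  have /andP[h1 h2] := slow_K_le aK xy.
  by rewrite ler0_norm ?subr_le0// ler0_norm ?subr_le0//; lra.
have /andP[h1 h2] := slow_K_le aK yx.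
by rewrite !ger0_norm ?subr_ge0//; lra.
Unshelve. all: end_near. Qed.

Lemma slow_K_class_K a : slow_K a -> class_K a.
Proof.
move=> aK; split; last exact: aK.1.
- exact/continuous_subspaceT/slow_K_continuous.
- by move=> r s r0 _; exact: slow_K_lt.
Qed.

(** Read [P t u] as the requirement that [a] be below [u] at [t]. The infimum
    over all such pairs of [u + max 0 (s - t)], and of [s] itself, is
    nondecreasing, 1-Lipschitz, and below every [u] required at [s]. It is
    positive at [s > 0]: pairs with [t <= s / 2] contribute at least [s / 2],
    and the others at least the bound assumed at [s / 2]. Multiplying it by
    [s / (1 + s)] makes it strictly increasing and keeps its increments below
    those of the identity. *)
Lemma slow_K_below P :
  (forall s, 0 < s ->
     exists2 d, 0 < d & forall t u, s <= t -> P t u -> d <= u) ->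
  exists a, [/\ slow_K a,
    (forall s u, 0 < s -> P s u -> a s < u) &
    (forall M, exists s, forall t u, s <= t -> P t u -> M <= u) ->
    forall M, exists s, forall t, s <= t -> M <= a t].
Proof.
move=> Ppos.
pose A s := [set y | y = s \/
  exists t u, [/\ 0 < t, P t u & y = u + Num.max 0 (s - t)]].
pose L s := inf (A s).
have Pge0 t u : 0 < t -> P t u -> 0 < u.
  by move=> t0 /[dup] Ptu; have [d d0 /(_ _ _ (lexx _))] := Ppos _ t0;
    move=> /[apply]; exact: lt_le_trans.
have max0 x : 0 <= Num.max 0 x :> R by rewrite le_max lexx.
have An s : A s !=set0 by exists s; left.
have Alb s : 0 <= s -> has_lbound (A s).
  move=> s0; exists 0 => y [->//|[t [u [t0 /(Pge0 _ _ t0) u0 ->]]]].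
  exact: addr_ge0 (ltW u0) (max0 _).
have Ls s y : 0 <= s -> A s y -> L s <= y.
  by move=> s0 Ay; apply: ge_inf => //; exact: Alb.
have gL s c : (forall y, A s y -> c <= y) -> c <= L s.
  by move=> h; apply: lb_le_inf => //; exact: An.
have Lle s : 0 <= s -> L s <= s by move=> s0; apply: Ls => //; left.
have LP s u : 0 < s -> P s u -> L s <= u.
  move=> s0 Psu; apply: Ls; first exact: ltW.
  by right; exists s, u; rewrite subrr maxxx addr0.
have Lmono s t : 0 <= s -> s <= t -> L s <= L t.
  move=> s0 st; apply: gL => y [->|[v [u [v0 Pvu ->]]]].
    by apply: le_trans st; exact: Lle.
  apply: (@le_trans _ _ (u + Num.max 0 (s - v))).
    by apply: Ls => //; right; exists v, u.
  by rewrite lerD2l ge_max max0/= le_max lerD2r st orbT.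
have Llip s t : 0 <= s -> s <= t -> L t <= L s + (t - s).
  move=> s0 st; rewrite -lerBlDr; apply: gL => y [->|[v [u [v0 Pvu ->]]]].
    by have := Lle t (le_trans s0 st); lra.
  have : L t <= u + Num.max 0 (t - v).
    by apply: Ls; [exact: le_trans st|right; exists v, u].
  by case: (leP 0 (t - v)); case: (leP 0 (s - v)); lra.
have Lge s c : 0 < s -> c <= s / 2 ->
    (forall t u, s / 2 <= t -> P t u -> c <= u) -> c <= L s.
  move=> s0 cs cP; apply: gL => y [->|[v [u [v0 Pvu ->]]]]; first by lra.
  have [sv|vs] := leP (s / 2) v.
    by apply: le_trans (cP _ _ sv Pvu) _; rewrite lerDl.
  have u0 := Pge0 _ _ v0 Pvu.
  have : s - v <= Num.max 0 (s - v) by rewrite le_max lexx orbT.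
  lra.
have Lpos s : 0 < s -> 0 < L s.
  move=> s0; have s20 : 0 < s / 2 by lra.
  have [d d0 dP] := Ppos _ s20.
  apply: (@lt_le_trans _ _ (Num.min (s / 2) d)); first by rewrite lt_min s20.
  apply: Lge => //; first by rewrite ge_min lexx.
  by move=> t u st Ptu; rewrite ge_min (dP _ _ st Ptu) orbT.
pose a s := if s <= 0 then 0 else L s * (s / (1 + s)).
exists a; split; first split.
- by move=> s s0; rewrite /a s0.
- move=> s t s0 st; have t0 : 0 < t by lra.
  rewrite /a (lt_geF t0).
  have Lt0 := Lpos _ t0.
  have ft : t / (1 + t) = 1 - (1 + t)^-1 by field; lra.
  have it : 0 < (1 + t)^-1 < 1.
    by rewrite invr_gt0 invf_lt1; lra.
  have [s0'|s0'] := leP s 0.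
    have -> : s = 0 by lra.
    rewrite !subr0 ft; have := Lle _ (ltW t0); nra.
  have fs : s / (1 + s) = 1 - (1 + s)^-1 by field; lra.
  have dst : (1 + s)^-1 - (1 + t)^-1 = (t - s) * ((1 + s)^-1 * (1 + t)^-1).
    by field; lra.
  have ist : 0 < (1 + s)^-1 < 1.
    by rewrite invr_gt0 invf_lt1; lra.
  have sis : s * (1 + s)^-1 = 1 - (1 + s)^-1 by [].
  have Ls0 := Lpos _ s0'.
  have := Llip _ _ s0 (ltW st).
  have := Lmono _ _ s0 (ltW st).
  have := Lle _ s0.
  rewrite fs ft.
  move: dst it ist sis; set p := (1 + s)^-1; set q := (1 + t)^-1.
  move: Ls0 Lt0; set x := L s; set y := L t.
  move=> x0 y0 dpq /andP[q0 q1] /andP[p0 p1] sp xs xy yxt.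
  (* With [x, y] the envelope at [s < t] and [p, q = 1 / (1 + s), 1 / (1 + t)],
     the increment is [y (1 - q) - x (1 - p)]; it falls short of [t - s] by at
     least [(t - s) p q]. *)
  have pq0 : 0 < p - q by rewrite dpq; apply: mulr_gt0; [lra|exact: mulr_gt0].
  have -> : y * (1 - q) - x * (1 - p) = (y - x) * (1 - q) + x * (p - q) by ring.
  have h1 : 0 <= (y - x) * (1 - q) <= (t - s) * (1 - q).
    by rewrite mulr_ge0 ?ler_pM2r; lra.
  have h2 : 0 < x * (p - q) <= s * (p - q).
    by rewrite mulr_gt0 ?ler_pM2r; lra.
  have h3 : s * (p - q) = (t - s) * (q * (1 - p)) by rewrite dpq -sp; ring.
  have h4 : 0 < (t - s) * (q * p) by rewrite !mulr_gt0//; lra.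
  have h5 : (t - s) * (1 - q) + (t - s) * (q * (1 - p)) =
    (t - s) - (t - s) * (q * p) by ring.
  by apply/andP; split; lra.
- move=> s u s0 Psu; rewrite /a (lt_geF s0).
  apply: lt_le_trans (LP _ _ s0 Psu).
  rewrite gtr_pMr; last exact: Lpos.
  by rewrite ltr_pdivrMr ?mul1r; lra.
- move=> Pinf M; have [s sP] := Pinf (2 * M).
  exists (Num.max 1 (Num.max (2 * s) (4 * M))) => t.
  rewrite !ge_max => /and3P[t1 ts tM].
  rewrite /a; case: ifP => [|_]; first by lra.
  have ML : 2 * M <= L t.
    by apply: Lge; [lra|lra|move=> v u vt; apply: sP; lra].
  have Lt0 : 0 < L t by apply: Lpos; lra.
  have ht : 1 / 2 <= t / (1 + t) by rewrite ler_pdivlMr ?mulrDr; lra.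
  apply: (@le_trans _ _ (L t * (1 / 2))); first by lra.
  by rewrite ler_pM2l.
Qed.

End SlowK.

(** The domain of the inverse is bounded because [th] itself may be bounded,
    so that its inverse need not be defined on the whole half-line; this is
    where the bound on admissible disturbances comes from. *)
Lemma slow_K_inverse (R : realType) (th : R -> R) : slow_K th ->
  exists g, class_K_upto (th 1)%:E g /\
    forall s, 0 <= s <= th 1 -> 0 <= g s /\ th (g s) = s.
Proof.
move=> thK; have [th0 _] := thK.
have /choice[g gP] s : exists v, 0 <= s <= th 1 -> 0 <= v <= 1 /\ th v = s.
  have [s01|] := boolP (0 <= s <= th 1); last by exists 0.
  have [v v01 <-] : exists2 v, v \in `[0, 1] & th v = s.
    apply: IVT => //.
      exact/continuous_subspaceT/slow_K_continuous.
    by rewrite (th0 0)// min_l ?max_r//; exact: slow_K_ge0.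
  by exists v => _; move: v01; rewrite in_itv.
have g0 s : 0 <= s <= th 1 -> 0 <= g s by move=> /gP[/andP[]].
have gmono : {in `[0, th 1] &, {mono g : x y / x <= y}}.
  apply: le_mono_in => x y; rewrite !in_itv/= => /gP[/andP[x0 x1] hx].
  move=> /gP[/andP[y0 y1] hy]; apply: contraTT; rewrite -!leNgt => yx.
  by rewrite -hx -hy; have /andP[] := slow_K_le thK yx.
have th10 : 0 <= th 1 by exact: slow_K_ge0.
have gth v : 0 <= v <= 1 -> g (th v) = v.
  move=> /andP[v0 v1].
  have tv : 0 <= th v <= th 1.
    by rewrite slow_K_ge0//=; have /andP[] := slow_K_le thK v1.
  have [/andP[h0 h1] h] := gP _ tv; apply/eqP; rewrite eq_le !leNgt.
  by apply/andP; split; apply/negP => /(slow_K_lt thK);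
    rewrite h ltxx => /(_ _)/negP; apply.
have g00 : g 0 = 0 by rewrite -[X in g X](th0 0)// gth// lexx ler01.
have g11 : g (th 1) = 1 by rewrite gth// lexx ler01.
exists g; split; last by move=> s /[dup] /g0 ? /gP[].
split => //.
- have cg : {within `[0, th 1], continuous g}.
    apply: segment_inc_surj_continuous => // v.
    rewrite g00 g11 /= in_itv/= => /[dup] v01 /gth gv; exists (th v) => //=.
    case/andP: v01 => v0 v1; rewrite in_itv/= slow_K_ge0//=.
    by have /andP[] := slow_K_le thK v1.
  apply: continuous_subspaceW cg => s /= [s0]; rewrite lte_fin => /ltW s1.
  by rewrite in_itv/= s0.
- move=> r s [r0]; rewrite lte_fin => /ltW r1 [s0]; rewrite lte_fin => /ltW s1 rs.
  by rewrite (leW_mono_in gmono)// in_itv/= ?r0 ?s0.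
Qed.

(** * Continuity on open sets, Euclidean norm and sup norm *)

Lemma open_continuous_at (T U : topologicalType) (A : set T) (f : T -> U) x :
  open A -> {within A, continuous f} -> A x -> {for x, continuous f}.
Proof.
move=> oA; rewrite continuous_open_subspace// => cf Ax.
by apply: cf; rewrite inE.
Qed.

Section Enorm.
Variables (R : realType) (n : nat).
Implicit Types x y : 'rV[R]_n.

Lemma enorm_ge0 x : 0 <= enorm x.
Proof. exact: sqrtr_ge0. Qed.

Lemma enorm0 : enorm (0 : 'rV[R]_n) = 0.
Proof.
by rewrite /enorm big1 ?sqrtr0// => i _; rewrite mxE expr0n.
Qed.

Lemma ler_coord_enorm x i : `|x 0 i| <= enorm x.
Proof.
rewrite -sqrtr_sqr ler_wsqrtr// (bigD1 i)//= lerDl.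
by apply: sumr_ge0 => j _; exact: sqr_ge0.
Qed.

Lemma enorm_eq0 x : enorm x = 0 -> x = 0.
Proof.
move=> x0; apply/rowP => i; rewrite mxE; apply/eqP.
by rewrite -normr_le0 -x0 ler_coord_enorm.
Qed.

Lemma enormZ c x : enorm (c *: x) = `|c| * enorm x.
Proof.
rewrite /enorm -sqrtr_sqr -sqrtrM ?sqr_ge0// mulr_sumr.
by congr Num.sqrt; apply: eq_bigr => i _; rewrite mxE exprMn.
Qed.

Lemma enorm_continuous : continuous (@enorm R n).
Proof.
move=> x; apply: continuous_comp; last exact: sqrt_continuous.
apply: continuous_big => [|i _ /= {}x]; first exact: add_continuous.
apply: (@continuous_comp _ _ _ (fun y : 'rV[R]_n => y 0 i) (fun t => t ^+ 2)).
  exact: coord_continuous.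
exact: exprn_continuous.
Qed.

Lemma enorm_sub_continuous y : continuous (fun x => enorm (x - y)).
Proof.
move=> x; apply: continuous_comp; last exact: enorm_continuous.
have : {for x, continuous ((fun z : 'rV[R]_n => z) - cst y)}.
  by apply: continuousB; [exact: cvg_id|exact: cst_continuous].
exact.
Qed.

Lemma closed_enorm_ball M : closed [set x : 'rV[R]_n | enorm x <= M].
Proof.
exact: ((continuous_closedP (@enorm R n)).1 enorm_continuous _ (@closed_le _ M)).
Qed.

Lemma enorm_ball_compact M : compact [set x : 'rV[R]_n | enorm x <= M].
Proof.
have cbox := @rV_compact R n (fun=> `[- M, M]%classic)
  (fun=> @segment_compact _ _ _).
apply: subclosed_compact cbox _.
  exact: closed_enorm_ball.
by move=> x /= xM i; rewrite in_itv/= -ler_norml (le_trans (ler_coord_enorm _ _)).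
Qed.

End Enorm.

Section Linf.
Variables (R : realType) (m : nat).
Implicit Types w : nat -> 'rV[R]_m.

Lemma linf_norm_ub w k : linf w -> enorm (w k) <= linf_norm w.
Proof. by move=> lw; apply: ub_le_sup => //; exists k. Qed.

Lemma linf_norm_ge0 w : linf w -> 0 <= linf_norm w.
Proof. by move=> /(linf_norm_ub 0); apply: le_trans; exact: enorm_ge0. Qed.

Lemma linf_bounded w c : (forall k, enorm (w k) <= c) -> linf w.
Proof. by move=> wc; exists c => _ [k _ <-]. Qed.

Lemma linf_norm_le w c : (forall k, enorm (w k) <= c) -> linf_norm w <= c.
Proof.
move=> wc; apply: ge_sup; first by exists (enorm (w 0%N)), 0%N.
by move=> _ [k _ <-].
Qed.

End Linf.

(** * Size functions *)

Section SizeFunction.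
Variables (R : realType) (n : nat) (S : set 'rV[R]_n) (xs : 'rV[R]_n).
Variable V : 'rV[R]_n -> R.
Hypotheses (oS : open S) (sV : size_function S xs V).

Lemma size_function_ge0 x : S x -> 0 <= V x.
Proof.
move=> Sx; have [_ V0 Vp _] := sV.
by have [->|/Vp/ltW->//] := pselect (x = xs); rewrite V0.
Qed.

Lemma size_function_continuous_at x : S x -> {for x, continuous V}.
Proof. by move=> Sx; have [cV _ _ _] := sV; exact: open_continuous_at cV Sx. Qed.

Let not_cvg (u : nat -> 'rV[R]_n) : (forall k, V (u k) <= 1) ->
  ~ V (u k) @[k --> \oo] --> +oo.
Proof.
move=> u1 /cvgryPgt /(_ 1)[N _ /(_ N (leqnn N))] /=.
by rewrite ltNge u1.
Qed.

(** Coercivity, applied to sequences in the sublevel set, shows that this set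
    is bounded and stays at a positive distance from the boundary of [S]; its
    closure therefore remains in [S] and is compact. The level [1] is
    arbitrary. *)
Lemma size_function_sublevel_compact :
  exists K, [/\ compact K, K `<=` S & forall x, S x -> V x <= 1 -> K x].
Proof.
have [_ _ _ coV] := sV.
pose A := [set x | S x /\ V x <= 1].
have [M AM] : exists M, forall x, A x -> enorm x <= M.
  apply: contrapT => hM.
  have /choice[u hu] (k : nat) : exists x, A x /\ k%:R < enorm x.
    apply: contrapT => hk; apply: hM; exists k%:R => x Ax.
    by rewrite leNgt; apply/negP => kx; apply: hk; exists x.
  apply: (@not_cvg u) => [k|]; first by have [[]] := hu k.
  apply: coV => [k|]; first by have [[]] := hu k.
  right; apply/cvgryPgt => B; near=> k.
  have [_] := hu k; apply: le_lt_trans.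
  near: k; exact: nbhs_infty_ger.
have [e e0 eA] : exists2 e, 0 < e &
    forall x y, A x -> boundary S y -> e <= enorm (x - y).
  apply: contrapT => he.
  have /choice[u hu] (k : nat) : exists x, A x /\
      exists2 y, boundary S y & enorm (x - y) < k.+1%:R^-1.
    apply: contrapT => hk; apply: he; exists k.+1%:R^-1; first by rewrite invr_gt0.
    move=> x y Ax Sy; rewrite leNgt; apply/negP => xy; apply: hk; exists x.
    by split => //; exists y.
  apply: (@not_cvg u) => [k|]; first by have [[]] := hu k.
  apply: coV => [k|]; first by have [[]] := hu k.
  left => d d0; near=> k.
  have [_ [y Sy uy]] := hu k; exists y => //; apply: lt_trans uy _.
  near: k; exact: near_infty_natSinv_lt (PosNum d0).
exists (closure A); split.
- apply: (subclosed_compact _ (@enorm_ball_compact R n M)).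
    exact: closed_closure.
  by have /closure_id -> := @closed_enorm_ball R n M; exact: closureS.
- move=> /= y Ay; apply: contrapT => nSy.
  have Sy : boundary S y.
    split; last by move=> /interior_subset.
    by apply: closureS Ay => x [].
  have : nbhs y [set x | enorm (x - y) < e].
    have := @enorm_sub_continuous R n y y.
    by rewrite /continuous_at subrr enorm0 => /cvgr_lt; exact.
  move=> /Ay[x [Ax]] /=; rewrite ltNge.
  by rewrite eA.
- by move=> x Sx Vx; apply: subset_closure.
Unshelve. all: end_near. Qed.

(** Outside the interior of [U], the compact set containing the sublevel set of
    [V] carries a positive minimum of [V]. *)
Lemma size_function_small U : nbhs xs U ->
  exists2 d, 0 < d & forall x, S x -> V x < d -> U x.
Proof.
move=> Uxs; have [K [cK KS SK]] := size_function_sublevel_compact.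
have cKU : compact (K `\` U°).
  apply: compact_closedI => //.
  by apply: open_closedC; exact: open_interior.
have [KU0|KU0] := pselect ((K `\` U°) !=set0); last first.
  exists 1 => // x Sx /ltW /(SK _ Sx) Kx; apply: contrapT => nU.
  by apply: KU0; exists x; split => // /interior_subset.
have cV : {within K `\` U°, continuous V}.
  apply: continuous_subspaceW; last by have [cV _ _ _] := sV; exact: cV.
  by move=> x [/KS].
have [c /set_mem[Kc nUc] cmin] := compact_EVT_min KU0 cKU cV.
have Vc : 0 < V c.
  by have [_ _ + _] := sV; apply; [exact: KS|move=> cxs; apply: nUc; rewrite cxs].
exists (Num.min 1 (V c)); first by rewrite lt_min ltr01.
move=> x Sx; rewrite lt_min => /andP[/ltW/(SK _ Sx) Kx Vxc].
apply: contrapT => nU; move: Vxc; rewrite ltNge cmin// inE; split => //.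
by move=> /interior_subset.
Qed.

End SizeFunction.

(** * Continuity of suprema *)

(** By compactness, the continuity of [G] at the points of [{x0} x K] is uniform
    in the second variable, and the supremum is 1-Lipschitz for the uniform
    distance. *)
Lemma continuous_sup_compact (R : realType) (X Y : topologicalType)
    (G : X -> Y -> R) (K : set Y) (x0 : X) :
  compact K -> K !=set0 ->
  (\forall x \near x0, has_ubound (G x @` K)) ->
  (forall y, K y -> {for (x0, y), continuous (fun p => G p.1 p.2)}) ->
  {for x0, continuous (fun x => sup (G x @` K))}.
Proof.
move=> /compact_near_coveringP cK K0 bG cG.
apply/cvgrPdist_le => /= e e0.
have hG : \forall x \near x0, K `<=` (fun y => `|G x0 y - G x y| <= e).
  apply: (cK _ (nbhs x0) (fun x y => `|G x0 y - G x y| <= e)) => y Ky.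
  have e20 : 0 < e / 2 by lra.
  have /cvgrPdist_le/(_ _ e20) [[/= A B] [Ax By] AB] := cG y Ky.
  exists (B, A) => //= -[y' x'] /= [By' Ax'].
  have h1 := AB (x', y') (conj Ax' By').
  have h2 := AB (x0, y') (conj (nbhs_singleton Ax) By').
  move: h1 h2 => /=.
  have -> : G x0 y' - G x' y' = (G x0 y - G x' y') - (G x0 y - G x0 y') by ring.
  move=> h1 h2; apply: le_trans (ler_normB _ _) _; lra.
have supK u z : has_ubound (u @` K) -> K z -> u z <= sup (u @` K) :> R.
  by move=> uK Kz; apply: ub_le_sup => //; exists z.
have lesup u v : has_ubound (v @` K) -> (forall z, K z -> u z <= v z + e) ->
    sup (u @` K) <= sup (v @` K) + e :> R.
  move=> vK uv; apply: ge_sup; first by case: K0 => z Kz; exists (u z), z.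
  by move=> _ [z Kz <-]; apply: le_trans (uv z Kz) _; rewrite lerD2r supK.
have b0 := nbhs_singleton bG.
near=> x.
have bx : has_ubound (G x @` K) by near: x.
have xx : forall y, K y -> `|G x0 y - G x y| <= e by near: x.
have h1 : sup (G x0 @` K) <= sup (G x @` K) + e.
  by apply: lesup => // z /xx; rewrite ler_norml => /andP[_ h]; lra.
have h2 : sup (G x @` K) <= sup (G x0 @` K) + e.
  by apply: lesup => // z /xx; rewrite ler_norml => /andP[h _]; lra.
by rewrite ler_norml; apply/andP; split; lra.
Unshelve. all: end_near. Qed.

Lemma continuous_scale_snd (R : realType) (T : topologicalType)
    (U : normedModType R) (phi : T -> R) (x : T) (u : U) :
  {for x, continuous phi} ->
  {for (x, u), continuous (fun p : T * U => phi p.1 *: p.2)}.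
Proof.
move=> cphi; apply: cvgZ; last exact: cvg_snd.
by apply: (@continuous_comp _ _ _ fst phi) => //; exact: cvg_fst.
Qed.

(** Up to [e], only the finitely many terms with [c k > e] matter. *)
Lemma continuous_sup_vanishing (R : realType) (X : topologicalType)
    (u : nat -> X -> R) (c : nat -> R) (x0 : X) :
  (forall k, {for x0, continuous (u k)}) -> c k @[k --> \oo] --> 0 ->
  (\forall x \near x0, has_ubound (range (u ^~ x))) ->
  (\forall x \near x0, forall k, 0 <= u k x <= c k) ->
  {for x0, continuous (fun x => sup (range (u ^~ x)))}.
Proof.
move=> cu c0 bu uc; apply/cvgrPdist_le => /= e e0.
have [N _ NP] : \forall k \near \oo, c k <= e by exact: cvgr_le c0 _ e0.
have uN : \forall x \near x0, forall i : 'I_N, `|u i x0 - u i x| <= e.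
  by apply: filter_forall => i; exact: (cvgrPdist_le _ _).1 (cu i) e e0.
have sup_le x y : has_ubound (range (u ^~ y)) -> 0 <= u 0%N y ->
    (forall k, u k x <= c k) -> (forall i : 'I_N, u i x <= u i y + e) ->
    sup (range (u ^~ x)) <= sup (range (u ^~ y)) + e.
  move=> uy uy0 xc xy; have usup k : u k y <= sup (range (u ^~ y)).
    by apply: ub_le_sup => //; exists k.
  apply: ge_sup => [|_ [k _ <-]]; first by exists (u 0%N x), 0%N.
  have [kN|Nk] := ltnP k N; first by have := xy (Ordinal kN); have /= := usup k; lra.
  by have := xc k; have := NP k Nk; have := usup 0%N; rewrite /=; lra.
have bx0 := nbhs_singleton bu; have ux0 := nbhs_singleton uc.
near=> x.
have bx : has_ubound (range (u ^~ x)) by near: x.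
have ux : forall k, 0 <= u k x <= c k by near: x.
have xN : forall i : 'I_N, `|u i x0 - u i x| <= e by near: x.
have ule z : (forall k, 0 <= u k z <= c k) -> forall k, u k z <= c k.
  by move=> zc k; have /andP[] := zc k.
have u0 z : (forall k, 0 <= u k z <= c k) -> 0 <= u 0%N z.
  by move=> zc; have /andP[] := zc 0%N.
have h1 : sup (range (u ^~ x0)) <= sup (range (u ^~ x)) + e.
  apply: sup_le (ule _ ux0) _ => // [|i]; first exact: u0.
  by have := xN i; rewrite ler_norml => /andP[_ h]; lra.
have h2 : sup (range (u ^~ x)) <= sup (range (u ^~ x0)) + e.
  apply: sup_le (ule _ ux) _ => // [|i]; first exact: u0.
  by have := xN i; rewrite ler_norml => /andP[h _]; lra.
by rewrite ler_norml; apply/andP; split; lra.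
Unshelve. all: end_near. Qed.

(** * Iterated scalar decay *)

Section Decay.
Variables (R : realType) (a : R -> R).
Hypothesis aK : slow_K a.

Definition decay s := s - a s.
Local Notation sg := decay.

Lemma decay_continuous : continuous sg.
Proof.
move=> x; apply: cvgB; first exact: cvg_id.
exact: slow_K_continuous.
Qed.

Lemma decay_lt : {homo sg : s t / s < t}.
Proof.
move=> s t st; rewrite /sg.
have [t0|t0] := leP t 0; first by rewrite !aK.1//; lra.
have [s0|s0] := leP 0 s; first by have /andP[_ h] := aK.2 _ _ s0 st; lra.
by have /andP[_ h] := slow_K_id aK t0; rewrite (aK.1 s) ?ltW//; lra.
Qed.

Lemma decay_le : {homo sg : s t / s <= t}.
Proof. exact: ltW_homo decay_lt. Qed.

Lemma decay_id s : sg s <= s.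
Proof. by rewrite /sg gerBl slow_K_ge0. Qed.

Lemma decay0 : sg 0 = 0.
Proof. by rewrite /sg aK.1 ?subr0. Qed.

Lemma iter_decay0 k : iter k sg 0 = 0.
Proof. by elim: k => //= k ->; exact: decay0. Qed.

Lemma iter_decay_lt k : {homo iter k sg : s t / s < t}.
Proof. by elim: k => //= k IH s t st; apply/decay_lt/IH. Qed.

Lemma iter_decay_le k : {homo iter k sg : s t / s <= t}.
Proof. exact: ltW_homo (@iter_decay_lt k). Qed.

Lemma iter_decay_ge0 k s : 0 <= s -> 0 <= iter k sg s.
Proof. by move=> s0; rewrite -(iter_decay0 k) iter_decay_le. Qed.

Lemma iter_decay_continuous k : continuous (iter k sg).
Proof.
elim: k => [|k IH] x /=; first exact: cvg_id.
apply: (@continuous_comp _ _ _ (iter k sg) sg); first exact: IH.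
exact: decay_continuous.
Qed.

Lemma iter_decay_nonincreasing s j k : (j <= k)%N ->
  iter k sg s <= iter j sg s.
Proof.
move=> /subnK <-; elim: (k - j)%N => //= i IH.
exact: le_trans (decay_id _) IH.
Qed.

(** As long as the iterates stay above [e], each step removes at least [a e]. *)
Lemma iter_decay_small s e : 0 < e -> exists k, iter k sg s < e.
Proof.
move=> e0; apply: contrapT => h.
have he k : e <= iter k sg s by rewrite leNgt; apply/negP => ?; apply: h; exists k.
have /andP[ae0 _] := slow_K_id aK e0.
have hk k : iter k sg s <= s - k%:R * a e.
  elim: k => [|k IH] /=; first by rewrite mul0r subr0.
  have /andP[ak _] := slow_K_le aK (he k).
  by rewrite /sg -natr1 mulrDl mul1r; lra.
pose N := (Num.truncn (s / a e)).+1.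
have : s / a e < N%:R := truncnS_gt _.
rewrite ltr_pdivrMr// => h1.
have := hk N; have := he N; lra.
Qed.

Lemma iter_decay_class_KL :
  class_KL (fun r t => iter (Num.truncn t) sg r).
Proof.
split=> [t t0|r r0].
  split; last exact: iter_decay0.
    exact/continuous_subspaceT/iter_decay_continuous.
  by move=> r s _ _; exact: iter_decay_lt.
split=> [s t s0 st|].
  by apply: iter_decay_nonincreasing; exact: le_truncn.
apply/cvgrPdist_le => /= e e0.
have [k ke] := iter_decay_small r e0.
near=> t.
rewrite sub0r normrN ger0_norm ?iter_decay_ge0//.
apply: le_trans (ltW ke); apply: iter_decay_nonincreasing.
have kt : k%:R <= t by near: t; exact: nbhs_pinfty_ge.
by rewrite -(@natrK R k); exact: le_truncn.
Unshelve. all: end_near. Qed.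

End Decay.

(** * A Lyapunov function gives input-to-state stability *)

Section System.
Variables (R : realType) (n m : nat) (S : set 'rV[R]_n).
Variables (f : 'rV[R]_n * 'rV[R]_m -> 'rV[R]_n) (xs : 'rV[R]_n).
Hypotheses (oS : open S) (fS : forall x w, S x -> S (f (x, w))).
Hypothesis cf : {within S `*` [set: 'rV[R]_m], continuous f}.
Hypotheses (Sxs : S xs) (fxs : f (xs, 0) = xs).

Lemma system_continuous_at x mu : S x -> {for (x, mu), continuous f}.
Proof.
move=> Sx; apply: open_continuous_at cf _ => //.
rewrite openE => -[y w] [Sy _].
exists (S, setT) => //; split; last exact: filterT.
exact: open_nbhs_nbhs.
Qed.

Lemma trajectory_in w x : S (x 0%N) -> trajectory f w x -> forall k, S (x k).
Proof. by move=> Sx tx; elim=> // k IH; rewrite tx; exact: fS. Qed.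

Lemma enorm_small U : nbhs (0 : 'rV[R]_m) U ->
  exists2 d, 0 < d & forall mu, enorm mu < d -> U mu.
Proof.
rewrite -nbhs_ballE => -[e /= e0 eU]; exists e => // mu mue; apply: eU.
split => // i j; rewrite (ord1 i) mxE /ball/= sub0r normrN.
exact: le_lt_trans (ler_coord_enorm _ _) mue.
Qed.

(** The relation [P] below collects the disturbances [mu] that are large
    relative to [V x] and for which the next value of [V] reaches [v]. By
    continuity at the equilibrium their norm is bounded below in terms of [v],
    so a class K function [th] fits under them: a disturbance of norm at most
    [th v] cannot push [V] to [v] or higher from a state at which no decrease
    is guaranteed. The gain is the inverse of [th]. *)
Lemma ISS_of_Lyapunov V :
  small_disturbance_ISS_Lyapunov S f xs V -> small_disturbance_ISS S f xs.
Proof.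
move=> [sV [a1 [a2 [a1K [a2K _] Vdec]]]].
have V0 x : S x -> 0 <= V x by exact: size_function_ge0 sV x.
have [|a [aK aa2 _]] := @slow_K_below R (fun s u => u = a2 s).
  move=> s s0.
  exists (a2 s); first exact: class_K_gt0.
  by move=> t _ st ->; apply: class_K_le => //; exact: ltW.
pose sg := decay a.
have Vsg x mu : S x -> enorm mu <= a1 (V x) -> V (f (x, mu)) <= sg (V x).
  move=> Sx /(Vdec _ _ Sx) => h; rewrite /sg /decay.
  have := V0 _ Sx; rewrite le_eqVlt => /orP[/eqP Vx0|/aa2/(_ erefl)]; last by lra.
  move: h; rewrite -Vx0 aK.1//; have [_ _ ->] := a2K; lra.
pose P v u := exists x mu,
  [/\ S x, u = enorm mu, a1 (V x) <= enorm mu & v <= V (f (x, mu))].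
have [|th [thK thP _]] := @slow_K_below R P.
  move=> v v0.
  have cV : {for (xs, 0), continuous (V \o f)}.
    apply: continuous_comp; first exact: system_continuous_at.
    by rewrite fxs; exact: (size_function_continuous_at oS sV).
  have [[/= A B] [Axs B0] AB] : \forall p \near (xs, 0 : 'rV[R]_m), V (f p) < v.
    by apply: cvgr_lt cV _ _; rewrite /= fxs; have [_ -> _ _] := sV.
  have [d1 d10 hd1] := size_function_small sV Axs.
  have [d2 d20 hd2] := enorm_small B0.
  have a1d : 0 < a1 d1 by exact: class_K_gt0.
  exists (Num.min d2 (a1 d1)); first by rewrite lt_min d20.
  move=> t _ vt [x [mu [Sx -> hx tV]]]; rewrite leNgt lt_min; apply/negP.
  move=> /andP[/hd2 Bmu mua1].
  have Vx : V x < d1.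
    rewrite ltNge; apply/negP => /(class_K_le a1K (ltW d10)).
    by rewrite leNgt (le_lt_trans hx mua1).
  have := AB (x, mu) (conj (hd1 _ Sx Vx) Bmu).
  by rewrite /= ltNge (le_trans vt tV).
have [g [gK gth]] := slow_K_inverse thK.
exists V, (th 1)%:E, (fun r t => iter (Num.truncn t) sg r), g; split => //.
- by rewrite lte_fin; have /andP[] := slow_K_id thK ltr01.
- exact: iter_decay_class_KL.
move=> w x lw; rewrite lte_fin => wth Sx0 tx.
have Sx := trajectory_in Sx0 tx.
have [gs0 thg] : 0 <= g (linf_norm w) /\ th (g (linf_norm w)) = linf_norm w.
  by apply: gth; rewrite linf_norm_ge0//= ltW.
set gs := g (linf_norm w) in gs0 thg *.
have step k : V (x k.+1) <= Num.max (sg (V (x k))) gs.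
  rewrite tx le_max; have [h|/ltW h] := leP (enorm (w k)) (a1 (V (x k))).
    by rewrite Vsg.
  have [|nle] := leP (V (f (x k, w k))) gs; first by rewrite orbT.
  have wk := linf_norm_ub k lw.
  (* A zero gain means a zero disturbance, for which the decrease holds. *)
  move: gs0; rewrite le_eqVlt => /orP[/eqP gs0|gs0].
    rewrite Vsg//; apply: le_trans wk _.
    by rewrite -thg -gs0 thK.1// class_K_ge0// V0.
  have : th gs < enorm (w k).
    by apply: thP => //; exists (x k), (w k); split=> //; exact: ltW.
  by rewrite thg ltNge wk.
have bound k : V (x k) <= Num.max (iter k sg (V (x 0%N))) gs.
  elim: k => [|k IH]; first by rewrite le_max lexx.
  apply: le_trans (step k) _; rewrite ge_max /= !le_max lexx orbT andbT.
  move: IH; rewrite le_max => /orP[h|h]; first by rewrite decay_le.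
  by apply/orP; right; exact: le_trans (decay_id aK _) h.
move=> k; split; first exact: Sx.
apply: le_trans (bound k) _; rewrite natrK ge_max lerDl gs0 lerDr.
by rewrite iter_decay_ge0// V0.
Qed.

End System.

(** * Input-to-state stability gives a robust stability margin *)

Section Robust.
Variables (R : realType) (n m : nat) (S : set 'rV[R]_n).
Variables (f : 'rV[R]_n * 'rV[R]_m -> 'rV[R]_n) (xs : 'rV[R]_n).
Hypotheses (fS : forall x w, S x -> S (f (x, w))).
Variable om : 'rV[R]_n -> R.
Hypothesis sV : size_function S xs om.

Fixpoint flow (w : nat -> 'rV[R]_m) (x : 'rV[R]_n) (k : nat) :=
  if k is j.+1 then f (flow w x j, w j) else x.

Lemma flow_eq w w' x k : trajectory f w x ->
  (forall j, (j < k)%N -> w' j = w j) -> flow w' (x 0%N) k = x k.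
Proof.
move=> tx; elim: k => //= k IH ww.
by rewrite IH ?ww ?tx// => j jk; apply: ww; exact: ltnW.
Qed.

(** Quantifying over these trajectories amounts to quantifying over the
    trajectories of the system [x+ = f (x, rho (om x) nu)] with inputs [nu] in
    the unit ball, hence over all state feedbacks within the margin. *)
Definition margin_trajectory (rho : R -> R) w x :=
  [/\ S (x 0%N), trajectory f w x & forall k, enorm (w k) <= rho (om (x k))].

Lemma margin_trajectory_shift rho w x j : margin_trajectory rho w x ->
  margin_trajectory rho (fun k => w (j + k)%N) (fun k => x (j + k)%N).
Proof.
move=> [Sx tx wx]; split => // [|k].
  by rewrite addn0; exact: (trajectory_in fS Sx tx).
by rewrite addnS tx.
Qed.

(** Uniform stability and uniform attractivity over all trajectories within
    the margin, in the epsilon-delta form that [fast_decay_gain] uses. *)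
Definition robustly_stable (rho : R -> R) := exists2 B : R -> R,
  B 0 = 0 /\ (forall r w x, 0 <= r -> margin_trajectory rho w x ->
    om (x 0%N) <= r -> forall k, om (x k) <= B r) &
  (forall r e, 0 < r -> 0 < e -> exists K, forall w x,
    margin_trajectory rho w x -> om (x 0%N) <= r ->
    forall k, (K <= k)%N -> om (x k) <= e).

Variables (d : \bar R) (b : R -> R -> R) (g : R -> R).
Hypotheses (d0 : (0 < d)%E) (bKL : class_KL b) (gK : class_K_upto d g).
Hypothesis ISS : forall (w : nat -> 'rV[R]_m) (x : nat -> 'rV[R]_n),
  linf w -> ((linf_norm w)%:E < d)%E -> S (x 0%N) -> trajectory f w x ->
  forall k : nat,
    S (x k) /\ om (x k) <= b (om (x 0%N)) k%:R + g (linf_norm w).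

Let B r := b r 0 + r / 2.

Let bK t : 0 <= t -> class_K (fun r => b r t).
Proof. by have [bK _] := bKL; exact: bK. Qed.

Let B0 : B 0 = 0.
Proof. by rewrite /B mul0r addr0; have [_ _] := bK (lexx 0). Qed.

Let B_ge0 r : 0 <= r -> 0 <= B r.
Proof.
move=> r0; rewrite addr_ge0//; last by lra.
exact: class_K_ge0 (bK (lexx 0)) r0.
Qed.

Let B_small s : 0 < s -> exists2 e, 0 < e & forall r, 0 <= r -> r < e -> B r < s.
Proof.
move=> s0; have s20 : 0 < s / 2 by lra.
have [e e0 eP] := class_K_on_small (bK (lexx 0)) (lexx 0) s20.
exists (Num.min e s); first by rewrite lt_min e0.
move=> r r0; rewrite lt_min => /andP[re rs].
by have := eP r r0; rewrite ger0_norm// => /(_ re); rewrite /B; lra.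
Qed.

(** The margin is chosen at the level [B r], which bounds everything reachable
    from [om <= r] while the gain term stays below [r / 2]. This avoids a
    circular dependence between the bound on the state and the bound on the
    disturbance. The constant [c] keeps the disturbances strictly inside the
    range [d] where the stability estimate applies. *)
Lemma robust_margin : exists rho, [/\ slow_K rho,
  (forall s, ((rho s)%:E < d)%E) & forall r, 0 <= r -> g (rho (B r)) <= r / 2].
Proof.
have [c c0 cd] : exists2 c : R, 0 < c & (c%:E < d)%E.
  case: (d) d0 => [r|_|//]; last by exists 1; rewrite ?ltry.
  by rewrite lte_fin => r0; exists (r / 2); rewrite ?lte_fin; lra.
pose P s u := u = c \/ exists r, [/\ 0 <= r, s <= B r, 0 <= u < c & r / 2 <= g u].
have [|rho [rK rP _]] := @slow_K_below R P.
  move=> s s0.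
  have [e e0 eP] := B_small s0.
  have e20 : 0 < e / 2 by lra.
  have [e' e'0 e'P] : exists2 e', 0 < e' &
      forall u, [set r | 0 <= r /\ (r%:E < d)%E] u -> `|u| < e' -> g u < e / 2.
    by apply: class_K_on_small gK _ e20; split.
  exists (Num.min c e'); first by rewrite lt_min c0.
  move=> t u st [->|[r [r0 tB /andP[u0 uc] gu]]]; first by rewrite ge_min lexx.
  rewrite ge_min; apply/orP; right; rewrite leNgt; apply/negP => ue'.
  have gue : g u < e / 2.
    apply: e'P; last by rewrite ger0_norm.
    by split => //; apply: lt_trans cd; rewrite lte_fin.
  have re : r < e by lra.
  by have := eP r r0 re; lra.
have rc s : rho s < c.
  have [s0|s0] := leP s 0; first by rewrite rK.1.
  by apply: rP => //; left.
exists rho; split => // [s|r r0].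
  by apply: lt_trans cd; rewrite lte_fin.
have := B_ge0 r0; rewrite le_eqVlt => /orP[/eqP <-|Br0].
  by rewrite rK.1//; have [_ _ ->] := gK; lra.
rewrite leNgt; apply/negP => h.
have : rho (B r) < rho (B r).
  by apply: rP => //; right; exists r; split=> //; rewrite ?slow_K_ge0//=; exact: ltW.
by rewrite ltxx.
Qed.

Section Margin.
Variable rho : R -> R.
Hypotheses (rK : slow_K rho) (rd : forall s, ((rho s)%:E < d)%E).
Hypothesis rg : forall r, 0 <= r -> g (rho (B r)) <= r / 2.

Let bounded_input r w x : 0 <= r -> S (x 0%N) -> trajectory f w x ->
  om (x 0%N) <= r -> (forall k, enorm (w k) <= rho (B r)) ->
  forall k, om (x k) <= b r k%:R + r / 2.
Proof.
move=> r0 Sx tx xr wr k.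
have lw := linf_bounded wr.
have nw := linf_norm_le wr.
have nd : ((linf_norm w)%:E < d)%E by apply: le_lt_trans (rd (B r)); rewrite lee_fin.
have [_ /le_trans->//] := ISS lw nd Sx tx k.
apply: lerD.
  exact: class_K_le (bK (ler0n _ k)) (size_function_ge0 sV Sx) xr.
apply: le_trans (rg r0); move: nw; rewrite le_eqVlt => /orP[/eqP->//|nw].
have [_ gS _] := gK; apply/ltW/gS => //; split=> //; first exact: linf_norm_ge0.
exact: slow_K_ge0.
Qed.

(** Strong induction on [k]: if the disturbance has respected [rho (B r)] before
    time [k], then cutting it off at [k] leaves [x k] unchanged and brings it
    into the scope of the stability estimate. Hence [om (x k) <= B r], and the
    margin condition bounds the disturbance at time [k] too. *)
Let margin_bound r w x : 0 <= r -> margin_trajectory rho w x ->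
  om (x 0%N) <= r -> forall k, om (x k) <= b r k%:R + r / 2.
Proof.
move=> r0 [Sx tx wx] xr.
have bB k : b r k%:R + r / 2 <= B r.
  by rewrite lerD2r; have [_ /(_ _ r0)[+ _]] := bKL; apply.
have rB0 : 0 <= rho (B r) by exact: slow_K_ge0.
suff wr k : enorm (w k) <= rho (B r) by exact: bounded_input.
elim/ltn_ind: k => k IH.
pose w' j := if (j < k)%N then w j else 0.
have xk : flow w' (x 0%N) k = x k by apply: flow_eq tx _ => j jk; rewrite /w' jk.
have : om (flow w' (x 0%N) k) <= b r k%:R + r / 2.
  apply: (@bounded_input r w') => // j; rewrite /w'.
  by case: ifPn => [/IH//|_]; rewrite enorm0.
rewrite xk => /le_trans/(_ (bB k)) h.
by apply: le_trans (wx k) _; have /andP[] := slow_K_le rK h.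
Qed.

Let margin_contract r : 0 < r -> exists T, forall w x,
  margin_trajectory rho w x -> om (x 0%N) <= r -> om (x T) <= r * (3 / 4).
Proof.
move=> r0; have [_ /(_ _ (ltW r0))[_ br]] := bKL.
have r40 : 0 < r / 4 by lra.
have [M [_ MP]] : \forall t \near +oo, b r t < r / 4.
  exact: cvgr_lt br _ r40.
exists (Num.truncn M).+1 => w x mx xr.
have := margin_bound (ltW r0) mx xr (Num.truncn M).+1.
have := MP _ (truncnS_gt M); lra.
Qed.

(** Contraction by [3 / 4] from restarted trajectories brings [om] below a level
    [h] from which [B] keeps it under [e] forever. *)
Lemma robustly_stable_margin : robustly_stable rho.
Proof.
exists B; first split => // r w x r0 mx xr k.
  apply: le_trans (margin_bound r0 mx xr k) _.
  by rewrite lerD2r; have [_ /(_ _ r0)[+ _]] := bKL; apply.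
move=> r e r0 e0; have [h h0 hP] := B_small e0.
have [N rN] : exists N, r * (3 / 4) ^+ N < h.
  have : (r * (3 / 4) ^+ N) @[N --> \oo] --> r * 0.
    by apply: cvgM; [exact: cvg_cst|apply: cvg_expr; rewrite ger0_norm; lra].
  by rewrite mulr0 => /cvgr_lt/(_ _ h0)[N _ /(_ _ (leqnn N))]; exists N.
have [K KP] : exists K, forall w x, margin_trajectory rho w x -> om (x 0%N) <= r ->
    om (x K) <= r * (3 / 4) ^+ N.
  elim: N {rN} => [|N [K KP]].
    by exists 0%N => w x _; rewrite expr0 mulr1.
  have rN0 : 0 < r * (3 / 4) ^+ N by rewrite mulr_gt0// exprn_gt0//; lra.
  have [T TP] := margin_contract rN0.
  exists (K + T)%N => w x mx xr.
  have -> : r * (3 / 4) ^+ N.+1 = r * (3 / 4) ^+ N * (3 / 4).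
    by rewrite exprSr [LHS]mulrA.
  apply: (TP _ _ (margin_trajectory_shift K mx)).
  by rewrite addn0; exact: KP mx xr.
exists K => w x mx xr k Kk; apply/ltW.
have rN0 : 0 <= r * (3 / 4) ^+ N by rewrite mulr_ge0// ?exprn_ge0//; lra.
apply: le_lt_trans (hP _ rN0 rN).
have xK : om (x (K + 0)%N) <= r * (3 / 4) ^+ N by rewrite addn0; exact: KP mx xr.
have := margin_bound rN0 (margin_trajectory_shift K mx) xK (k - K)%N.
move=> /=; rewrite subnKC// => /le_trans; apply.
by rewrite lerD2r; have [_ /(_ _ rN0)[+ _]] := bKL; apply.
Qed.

End Margin.

Lemma ISS_robustly_stable : exists rho, slow_K rho /\ robustly_stable rho.
Proof.
have [rho [rK rd rg]] := robust_margin.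
by exists rho; split=> //; exact: robustly_stable_margin.
Qed.

End Robust.

(** * Robust stability gives a Lyapunov function *)

Section Converse.
Variables (R : realType) (n m : nat) (S : set 'rV[R]_n).
Variables (f : 'rV[R]_n * 'rV[R]_m -> 'rV[R]_n) (xs : 'rV[R]_n).
Hypotheses (oS : open S) (fS : forall x w, S x -> S (f (x, w))).
Hypothesis cf : {within S `*` [set: 'rV[R]_m], continuous f}.
Hypothesis Sxs : S xs.
Variables (om : 'rV[R]_n -> R) (rho : R -> R).
Hypotheses (sV : size_function S xs om) (rK : slow_K rho).
Hypothesis stab : @robustly_stable R n m S f om rho.

Local Notation margin := (@margin_trajectory R n m S f om rho).

Let om_ge0 x : S x -> 0 <= om x.
Proof. exact: (size_function_ge0 sV). Qed.

Let om_xs : om xs = 0.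
Proof. by case: sV. Qed.

Let margin_in w x k : margin w x -> S (x k).
Proof. by move=> [Sx tx _]; exact: (trajectory_in fS Sx tx). Qed.

Lemma margin_exists x : S x -> exists w y, margin w y /\ y 0%N = x.
Proof.
move=> Sx; exists (fun=> 0), (flow f (fun=> 0) x); split => //; split => //.
by move=> k; rewrite enorm0 slow_K_ge0.
Qed.

Lemma margin_cons x mu w y : S x -> enorm mu <= rho (om x) ->
  margin w y -> y 0%N = f (x, mu) ->
  margin (fun k => if k is j.+1 then w j else mu)
         (fun k => if k is j.+1 then y j else x).
Proof. by move=> Sx mux [Sy ty wy] yx; split => // -[|k]. Qed.

(** Sontag's lemma in the form needed here. At level [t], [P] records the
    values [t / 4^k] for all times [k] at which a trajectory started with
    [om <= 1 / t] still has size [t]. Uniform attractivity bounds these times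
    for [t] away from [0], so a class K function [F] fits below. A trajectory
    started with [om <= r] is controlled by this choice while its size is at
    most [1 / r]; before that, only finitely many times [k] occur. *)
Lemma fast_decay_gain : exists F, [/\ slow_K F,
  (forall M, exists s, forall t, s <= t -> M <= F t) &
  forall r, 0 < r -> exists C, forall w x, margin w x -> om (x 0%N) <= r ->
    forall k, F (om (x k)) <= C / 4 ^+ k].
Proof.
have [B [B0 Bbnd] settle] := stab.
pose P t u := exists k w x,
  [/\ margin w x, om (x 0%N) <= t^-1, om (x k) = t & u = t / 4 ^+ k].
have Psettle s : 0 < s -> exists K, forall t u, s <= t -> P t u -> t / 4 ^+ K <= u.
  move=> s0; have si0 : 0 < s^-1 by rewrite invr_gt0.
  have s20 : 0 < s / 2 by lra.
  have [K KP] := settle _ _ si0 s20.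
  exists K => t u st [k [w [x [mx x0 xk ->]]]].
  have t0 : 0 < t by exact: lt_le_trans st.
  rewrite ler_pM2l// lef_pV2 ?posrE ?exprn_gt0// ler_weXn2l ?ler1n//.
  rewrite leqNgt; apply/negP => /ltnW Kk.
  have xs1 : om (x 0%N) <= s^-1 by rewrite (le_trans x0)// lef_pV2.
  by have := KP w x mx xs1 k Kk; rewrite xk; lra.
have [|F [FK FP Finf]] := @slow_K_below R P.
  move=> s s0; have [K KP] := Psettle s s0.
  exists (s / 4 ^+ K); first by rewrite divr_gt0// exprn_gt0.
  move=> t u st Ptu; apply: le_trans (KP t u st Ptu).
  by rewrite ler_pM2r// invr_gt0 exprn_gt0.
exists F; split => //.
  apply: Finf => M; have [K KP] := Psettle 1 ltr01.
  exists (Num.max 1 (M * 4 ^+ K)) => t u; rewrite ge_max => /andP[t1 tM] Ptu.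
  by apply: le_trans (KP t u t1 Ptu); rewrite ler_pdivlMr// exprn_gt0.
move=> r r0; have ri0 : 0 < r^-1 by rewrite invr_gt0.
have [K KP] := settle r r^-1 r0 ri0.
have Br0 : 0 <= B r.
  have [w [y [my yx]]] := margin_exists Sxs.
  have := Bbnd r w y (ltW r0) my; rewrite yx om_xs => /(_ (ltW r0) 0%N).
  by rewrite yx om_xs.
have BK0 : 0 <= B r * 4 ^+ K by rewrite mulr_ge0// exprn_ge0.
exists (r^-1 + B r * 4 ^+ K) => w x mx xr k.
have k40 : 0 < 4 ^+ k :> R by rewrite exprn_gt0.
rewrite ler_pdivlMr//.
have := om_ge0 (margin_in k mx); rewrite le_eqVlt => /orP[/eqP <-|s0].
  by rewrite FK.1// mul0r; lra.
have [sr|rs] := leP (om (x k)) r^-1.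
  suff : F (om (x k)) < om (x k) / 4 ^+ k by rewrite ltr_pdivlMr//; lra.
  apply: FP => //; exists k, w, x; split => //.
  by rewrite (le_trans xr)// -[r]invrK lef_pV2.
suff : F (om (x k)) * 4 ^+ k <= B r * 4 ^+ K by lra.
have kK : (k <= K)%N.
  rewrite leqNgt; apply/negP => /ltnW /(KP w x mx xr).
  by rewrite leNgt rs.
have /andP[_ Fs] := slow_K_id FK s0.
apply: ler_pM; [exact: slow_K_ge0|exact: ltW| |].
  by apply: le_trans (ltW Fs) _; exact: (Bbnd _ _ _ (ltW r0) mx xr k).
by rewrite ler_weXn2l// ler1n.
Qed.

Section Value.
Variable F : R -> R.
Hypothesis FK : slow_K F.
Hypothesis Finf : forall M, exists s, forall t, s <= t -> M <= F t.
Hypothesis Fdecay :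
  forall r, 0 < r -> exists C, forall w x, margin w x -> om (x 0%N) <= r ->
    forall k, F (om (x k)) <= C / 4 ^+ k.

Let ball1 : set 'rV[R]_m := [set nu | enorm nu <= 1].

Let ball1_n0 : ball1 !=set0.
Proof. by exists 0; rewrite /ball1/= enorm0. Qed.

(** Rescaling the disturbance to the unit ball makes the set of controls
    independent of the state, so that [continuous_sup_compact] applies. *)
Let next x nu := f (x, rho (om x) *: nu).

Let next_in x nu : S x -> S (next x nu).
Proof. exact: fS. Qed.

Let next_margin x nu : ball1 nu -> enorm (rho (om x) *: nu) <= rho (om x).
Proof.
move=> nu1; rewrite enormZ ger0_norm ?slow_K_ge0//.
by rewrite ler_piMr// slow_K_ge0.
Qed.

(** The supremum of [2 ^ k * F (om (y k))] over margin trajectories [y] from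
    [x], in dynamic programming form: continuity and the decrease along the
    system are immediate from the recursion. *)
Fixpoint stage_value k x := if k is j.+1
  then 2 * sup ((fun nu => stage_value j (next x nu)) @` ball1) else F (om x).

(** Unrolls the recursion: prepending [x] to a margin trajectory from
    [next x nu] gives one from [x], so the recursively defined value does not
    exceed the supremum over trajectories that it stands for. *)
Let stage_value_le k x c : S x ->
  (forall w y, margin w y -> y 0%N = x -> F (om (y k)) <= c) ->
  stage_value k x <= 2 ^+ k * c.
Proof.
elim: k x => [|k IH] x Sx xc.
  have [w [y [my yx]]] := margin_exists Sx.
  by rewrite expr0 mul1r /=; have := xc w y my yx; rewrite yx.
rewrite exprS -mulrA /= ler_pM2l//; apply: ge_sup.
  by case: ball1_n0 => nu nu1; exists (stage_value k (next x nu)), nu.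
move=> _ [nu nu1 <-]; apply: IH => [|w y my y0]; first exact: next_in.
exact: (xc _ _ (margin_cons Sx (next_margin x nu1) my y0)).
Qed.

Let stage_value_bound r : 0 < r -> exists C, forall x, S x -> om x <= r ->
  forall k, stage_value k x <= C / 2 ^+ k.
Proof.
move=> r0; have [C CP] := Fdecay r0; exists C => x Sx xr k.
have -> : C / 2 ^+ k = 2 ^+ k * (C / 4 ^+ k).
  have -> : 4 = 2 * 2 :> R by ring.
  by rewrite exprMn; field; rewrite expf_neq0.
by apply: stage_value_le => // w y my yx; apply: CP my _ k; rewrite yx.
Qed.

Let stage_value_next_ubound x k : S x ->
  has_ubound ((fun nu => stage_value k (next x nu)) @` ball1).
Proof.
move=> Sx; have r0 : 0 < om x + 1 by have := om_ge0 Sx; lra.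
have [C CP] := Fdecay r0.
exists (2 ^+ k * (C / 4 ^+ k.+1)) => _ [nu nu1 <-].
apply: stage_value_le => [|w y my y0]; first exact: next_in.
by apply: (CP _ _ (margin_cons Sx (next_margin x nu1) my y0) _ k.+1); lra.
Qed.

Let stage_value_next k x nu : S x -> ball1 nu ->
  stage_value k (next x nu) <= stage_value k.+1 x / 2.
Proof.
move=> Sx nu1; rewrite /= mulrC mulKf//.
by apply: ub_le_sup; [exact: stage_value_next_ubound|exists nu].
Qed.

Let stage_value_ge0 k x : S x -> 0 <= stage_value k x.
Proof.
elim: k x => [|k IH] x Sx; first exact: slow_K_ge0.
case: ball1_n0 => nu nu1.
by have := stage_value_next k Sx nu1; have := IH _ (next_in nu Sx); lra.
Qed.

Let om_continuous x : S x -> {for x, continuous om}.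
Proof. exact: (size_function_continuous_at oS sV). Qed.

Let stage_value_continuous k x : S x -> {for x, continuous (stage_value k)}.
Proof.
elim: k x => [|k IH] x Sx.
  apply: continuous_comp; first exact: om_continuous.
  exact: slow_K_continuous.
have nS : \forall y \near x, S y by exact: open_nbhs_nbhs.
suff cs : {for x, continuous
    (fun y => sup ((fun nu => stage_value k (next y nu)) @` ball1))}.
  have -> : stage_value k.+1 =
      cst 2 * (fun y => sup ((fun nu => stage_value k (next y nu)) @` ball1)) by [].
  by apply: continuousM => //; exact: cst_continuous.
apply: continuous_sup_compact => //.
- exact: enorm_ball_compact.
- by apply: filterS nS => y; exact: stage_value_next_ubound.
move=> nu nu1.
apply: (@continuous_comp _ _ _ (fun p => next p.1 p.2) (stage_value k)); last first.
  by apply: IH; exact: next_in.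
apply: (@continuous_comp _ _ _
  (fun p : 'rV[R]_n * 'rV[R]_m => (p.1, rho (om p.1) *: p.2)) f).
  have c1 : {for x, continuous (rho \o om)}.
    apply: continuous_comp; first exact: om_continuous.
    exact: slow_K_continuous.
  have c2 := @continuous_scale_snd R _ 'rV[R]_m _ _ nu c1.
  exact: (cvg_pair cvg_fst c2).
exact: (system_continuous_at oS cf).
Qed.

Definition value_function x := sup (range (stage_value ^~ x)).

Let value_function_ubound x : S x -> has_ubound (range (stage_value ^~ x)).
Proof.
move=> Sx; have r0 : 0 < om x + 1 by have := om_ge0 Sx; lra.
have [C CP] := stage_value_bound r0; exists C => _ [k _ <-].
have xr : om x <= om x + 1 by lra.
have C0 : 0 <= C.
  have := CP x Sx xr 0%N; rewrite expr0 divr1; apply: le_trans.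
  exact: stage_value_ge0.
apply: le_trans (CP x Sx xr k) _.
by rewrite ler_pdivrMr ?exprn_gt0// ler_peMr// exprn_ege1// ler1n.
Qed.

Let value_function_ub k x : S x -> stage_value k x <= value_function x.
Proof. by move=> Sx; apply: ub_le_sup; [exact: value_function_ubound|exists k]. Qed.

Let value_function_le x c : (forall k, stage_value k x <= c) -> value_function x <= c.
Proof.
move=> xc; apply: ge_sup; first by exists (stage_value 0%N x), 0%N.
by move=> _ [k _ <-].
Qed.

Let value_function_next x nu : S x -> ball1 nu ->
  value_function (next x nu) <= value_function x / 2.
Proof.
move=> Sx nu1; apply: value_function_le => k.
by have := stage_value_next k Sx nu1; have := value_function_ub k.+1 Sx; lra.
Qed.

Let value_function_ge x : S x -> F (om x) <= value_function x.
Proof. exact: (value_function_ub 0). Qed.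

Let value_function_xs : value_function xs = 0.
Proof.
apply/eqP; rewrite eq_le; apply/andP; split; last first.
  exact: le_trans (stage_value_ge0 0 Sxs) (value_function_ub 0 Sxs).
apply: value_function_le => k; rewrite -(mulr0 (2 ^+ k)).
apply: stage_value_le => // w y my yx.
have [B [B0 Bbnd] _] := stab.
have := Bbnd 0 w y (lexx _) my; rewrite yx om_xs B0 => /(_ (lexx _) k) h.
by rewrite FK.1.
Qed.

Let value_function_continuous x : S x -> {for x, continuous value_function}.
Proof.
move=> Sx; have r0 : 0 < om x + 1 by have := om_ge0 Sx; lra.
have [C CP] := stage_value_bound r0.
have nS : \forall y \near x, S y by exact: open_nbhs_nbhs.
have nr : \forall y \near x, om y <= om x + 1.
  by apply: cvgr_le (om_continuous Sx) _ _; lra.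
apply: (@continuous_sup_vanishing R _ stage_value (fun k => C / 2 ^+ k)).
- by move=> k; exact: stage_value_continuous.
- rewrite -(mulr0 C); apply: cvgM; first exact: cvg_cst.
  under eq_fun do rewrite -exprVn.
  by apply: cvg_expr; rewrite ger0_norm; lra.
- by apply: filterS nS => y; exact: value_function_ubound.
- apply: filterS2 nS nr => y Sy yr k; rewrite stage_value_ge0//.
  exact: CP.
Qed.

Let value_function_gt0 x : S x -> x <> xs -> 0 < value_function x.
Proof.
move=> Sx xxs; apply: lt_le_trans (value_function_ge Sx).
have [_ _ omp _] := sV.
by have /andP[] := slow_K_id FK (omp _ Sx xxs).
Qed.

Lemma size_function_value_function : size_function S xs value_function.
Proof.
split => //.
  apply: continuous_in_subspaceT => x /set_mem.
  exact: value_function_continuous.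
move=> u Su uS; have [_ _ _ coV] := sV.
have ou := coV u Su uS.
apply/cvgryPge => M; have [s sP] := Finf M.
have : \forall k \near \oo, s <= om (u k) by move/cvgryPge : ou; exact.
by apply: filterS => k /sP /le_trans; apply; exact: value_function_ge.
Qed.

(** The value function halves at each step within the margin. The margin is
    [rho (om x)], which the class K function [a] bounds from below in terms of
    the value function, because the latter is small wherever [om] is. *)
Lemma Lyapunov_value_function : f (xs, 0) = xs ->
  small_disturbance_ISS_Lyapunov S f xs value_function.
Proof.
move=> fxs; split; first exact: size_function_value_function.
pose P v u := exists x, [/\ S x, v = value_function x & u = rho (om x)].
have [|a [aK aP _]] := @slow_K_below R P.
  move=> v v0.
  have : \forall x \near xs, value_function x < v.
    apply: cvgr_lt (value_function_continuous Sxs) _ _.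
    by rewrite value_function_xs.
  move=> /(size_function_small sV)[e e0 eP].
  exists (rho e); first by have /andP[] := slow_K_id rK e0.
  move=> t u vt [x [Sx tx ->]]; rewrite leNgt; apply/negP => h.
  have : value_function x < v.
    apply: eP => //; rewrite ltNge; apply/negP => ex.
    by have /andP[] := slow_K_le rK ex; lra.
  lra.
exists a, (fun v => v / 2); split.
- exact: slow_K_class_K.
- split; last first.
    apply/cvgryPge => M; exists (2 * M); split; first exact: num_real.
    by move=> v /= Mv; lra.
  split; last by rewrite mul0r.
    by apply: continuous_subspaceT => v; apply: cvgM; [exact: cvg_id|exact: cvg_cst].
  by move=> r s _ _ rs; lra.
- move=> x mu Sx mua.
  suff : value_function (f (x, mu)) <= value_function x / 2 by lra.
  have [xE|xxs] := pselect (x = xs).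
    have -> : mu = 0.
      apply: enorm_eq0; apply/eqP; rewrite eq_le enorm_ge0 andbT.
      by rewrite (le_trans mua)// xE value_function_xs aK.1.
    by rewrite xE fxs value_function_xs mul0r.
  have ox : 0 < om x by have [_ _ + _] := sV; apply.
  have rx : 0 < rho (om x) by have /andP[] := slow_K_id rK ox.
  have -> : f (x, mu) = next x ((rho (om x))^-1 *: mu).
    by rewrite /next scalerA divff ?scale1r// gt_eqF.
  apply: value_function_next => //; rewrite /ball1/= enormZ ger0_norm; last first.
    by rewrite invr_ge0; exact: ltW.
  rewrite ler_pdivrMl// mulr1; apply: le_trans mua _; apply: ltW.
  by apply: aP; [exact: value_function_gt0|exists x].
Qed.

End Value.

Lemma Lyapunov_of_robustly_stable : f (xs, 0) = xs ->
  exists V, small_disturbance_ISS_Lyapunov S f xs V.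
Proof.
move=> fxs; have [F [FK Finf Fdecay]] := fast_decay_gain.
by exists (value_function F); exact: Lyapunov_value_function.
Qed.

End Converse.

(** * The equivalence *)

Theorem theorem15 (R : realType) (n m : nat) (S : set 'rV[R]_n)
    (f : 'rV[R]_n * 'rV[R]_m -> 'rV[R]_n) (xstar : 'rV[R]_n)
    (S_open : open S)
    (S_homeo : homeomorphic S [set: 'rV[R]_n])
    (f_maps : forall x w, S x -> S (f (x, w)))
    (f_cont : {within S `*` [set: 'rV[R]_m], continuous f})
    (xstar_in : S xstar)
    (xstar_eq : f (xstar, 0) = xstar) :
  small_disturbance_ISS S f xstar <->
  exists V : 'rV[R]_n -> R, small_disturbance_ISS_Lyapunov S f xstar V.
Proof.
split=> [[om [d [b [g [sV d0 bKL gK ISS]]]]]|[V LV]].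
- have [rho [rK stab]] := ISS_robustly_stable f_maps sV d0 bKL gK ISS.
  exact: (Lyapunov_of_robustly_stable S_open f_maps f_cont xstar_in sV rK stab).
- exact: (ISS_of_Lyapunov S_open f_maps f_cont xstar_in xstar_eq LV).
Qed.
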